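(* Let $m\ge 2$ be an integer. The function $$\phi_{\mathfrak{B}_m}(w)=\frac{1}{(m-1)m(m+1)}\,w^{m+1},\qquad w\in\mathbb{C},$$ gives rise to Bour's minimal surface $\mathfrak{B}_m$ through the integral free form of the Weierstrass representation; that is, with $\phi=\phi_{\mathfrak{B}_m}$ and $w=re^{i\theta}$, $$\mathrm{Re}\begin{pmatrix}(1-w^2)\phi''(w)+2w\phi'(w)-2\phi(w)\\ i\left[(1+w^2)\phi''(w)-2w\phi'(w)+2\phi(w)\right]\\ 2\left[w\phi''(w)-\phi'(w)\right]\end{pmatrix}=\mathfrak{B}_m(r,\theta).$$
   Context: Bour's minimal surface of value $m$ is given in polar coordinates $\zeta=re^{i\theta}$ by $$\mathfrak{B}_m(r,\theta)=\begin{pmatrix} r^{m-1}\frac{\cos[(m-1)\theta]}{m-1}-r^{m+1}\frac{\cos[(m+1)\theta]}{m+1}\\ -r^{m-1}\frac{\sin[(m-1)\theta]}{m-1}-r^{m+1}\frac{\sin[(m+1)\theta]}{m+1}\\ 2r^m\frac{\cos(m\theta)}{m}\end{pmatrix}.$$ The integral free form of the Weierstrass representation associates to a function $\phi$ the surface $$\begin{pmatrix} x \\ y \\ z \end{pmatrix}=\mathrm{Re}\begin{pmatrix}(1-w^2)\phi''(w)+2w\phi'(w)-2\phi(w)\\ i\left[(1+w^2)\phi''(w)-2w\phi'(w)+2\phi(w)\right]\\ 2\left[w\phi''(w)-\phi'(w)\right]\end{pmatrix},$$ where primes denote complex derivatives with respect to $w$. *)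

(* Defs.v *)
From HB Require Import structures.
From mathcomp Require Import all_boot all_order all_algebra.
From mathcomp Require Import complex.
From mathcomp Require Import all_classical all_reals all_analysis.

Set Implicit Arguments.
Unset Strict Implicit.
Unset Printing Implicit Defensive.

Import Order.TTheory GRing.Theory Num.Theory.
Import numFieldNormedType.Exports.

Local Open Scope ring_scope.
Local Open Scope complex_scope.

Definition vec3 (K : Type) (x y z : K) : 'cV[K]_3 :=
  \col_(i < 3) tnth [tuple x; y; z] i.

(* The ascription to numFieldType gives R[i] the topology and the
   normed module structure over itself induced by its modulus, so that
   [derive1] on functions [Cplx R -> Cplx R] is the complex derivative. *)
Definition Cplx (R : realType) : numFieldType := R[i].

Definition polar (R : realType) (r theta : R) : Cplx R :=
  r%:C * (cos theta +i* sin theta).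

(* Only meaningful for 2 <= m, where the natural number m - 1 is a true
   predecessor and all the denominators are nonzero. *)
Definition bour (R : realType) (m : nat) (r theta : R) : 'cV[R]_3 :=
  vec3
    (r ^+ (m - 1) * (cos ((m - 1)%:R * theta) / (m - 1)%:R)
      - r ^+ (m + 1) * (cos ((m + 1)%:R * theta) / (m + 1)%:R))
    (- (r ^+ (m - 1) * (sin ((m - 1)%:R * theta) / (m - 1)%:R))
      - r ^+ (m + 1) * (sin ((m + 1)%:R * theta) / (m + 1)%:R))
    (2 * r ^+ m * (cos (m%:R * theta) / m%:R)).

Definition weierstrass (R : realType) (phi : Cplx R -> Cplx R) (w : Cplx R)
  : 'cV[R]_3 :=
  let i : Cplx R := 'i%C in
  let phi1 := (phi^`())%classic in
  let phi2 := (phi^`(2))%classic in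
  map_mx (@complex.Re R) (vec3
    ((1 - w ^+ 2) * phi2 w + 2 * w * phi1 w - 2 * phi w)
    (i * ((1 + w ^+ 2) * phi2 w - 2 * w * phi1 w + 2 * phi w))
    (2 * (w * phi2 w - phi1 w))).

Definition phi_bour (R : realType) (m : nat) (w : Cplx R) : Cplx R :=
  ((m - 1)%:R * m%:R * (m + 1)%:R)^-1 * w ^+ (m + 1).

(* Main.v *)
Require Import Defs.
From mathcomp Require Import all_boot all_order all_algebra.
From mathcomp Require Import complex ring.
From mathcomp Require Import all_classical all_reals all_analysis.

Local Open Scope ring_scope.

Import GRing.Theory Num.Theory numFieldNormedType.Exports.
Local Open Scope complex_scope.

(** The constant in $\phi$ is chosen so that $\phi''(w) = w^{m-1}/(m-1)$. All terms are then
    monomials, and the three entries collapse to $w^{m-1}/(m-1) - w^{m+1}/(m+1)$, $i(w^{m-1}/(m-1) +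
    w^{m+1}/(m+1))$ and $2w^m/m$ ([weierstrass_phi_bour]). De Moivre's formula ([polarX]) then gives
    their real parts at $w = re^{i\theta}$. *)

(** At [n = 0] the truncated exponent [n.-1] is harmless, since the factor [n%:R] vanishes. *)
Lemma derive1_monomial (K : numFieldType) (c : K) (n : nat) :
  ((fun x : K => c * x ^+ n)^`())%classic = (fun x : K => c * n%:R * x ^+ n.-1).
Proof.
apply/funext => x; rewrite derive1Ml; last exact: exprn_derivable.
by rewrite exp_derive1 -[n%:R *: _]/(n%:R * _) mulrA.
Qed.

(** De Moivre's formula, by induction with the addition formulas; [r] may have any sign. *)
Lemma polarX (R : realType) (r theta : R) (n : nat) :
  polar r theta ^+ n =
    (r ^+ n * cos (n%:R * theta)) +i* (r ^+ n * sin (n%:R * theta)).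
Proof.
elim: n => [|n IHn].
  by rewrite !expr0 mul0r cos0 sin0 mulr0 mulr1.
rewrite exprS IHn -natr1 mulrDl mul1r cosD sinD exprS.
apply/eqP; rewrite eq_complex /=; apply/andP; split; apply/eqP; ring.
Qed.

Lemma Re_divn (R : realType) (z : R[i]) (n : nat) :
  complex.Re (z / n%:R) = complex.Re z / n%:R.
Proof.
(* The inverse of [n%:R] becomes an embedded real number, so the cross term of the product
   vanishes. *)
rewrite -(rmorph_nat (real_complex R)) -fmorphV; case: z => a b /=.
by rewrite mulr0 subr0.
Qed.

Lemma Im_divn (R : realType) (z : R[i]) (n : nat) :
  complex.Im (z / n%:R) = complex.Im z / n%:R.
Proof.
rewrite -(rmorph_nat (real_complex R)) -fmorphV; case: z => a b /=.
by rewrite mulr0 add0r.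
Qed.

Lemma Re_mulil (R : realType) (z : R[i]) :
  complex.Re ('i * z) = - complex.Im z.
Proof. by case: z => a b /=; rewrite mul0r mul1r sub0r. Qed.

(** Writing $m = n+2$ turns $m-1$, $m$, $m+1$ into successors, hence nonzero in characteristic 0. *)
Lemma weierstrass_phi_bour (R : realType) (n : nat) (w : Cplx R) :
  weierstrass (@phi_bour R n.+2) w =
  map_mx (@complex.Re R) (vec3
    (w ^+ n.+1 / n.+1%:R - w ^+ n.+3 / n.+3%:R : Cplx R)
    ('i * (w ^+ n.+1 / n.+1%:R + w ^+ n.+3 / n.+3%:R))
    (2 * (w ^+ n.+2 / n.+2%:R))).
Proof.
have nz k : k.+1%:R != 0 :> Cplx R by rewrite pnatr_eq0.
have phiE : @phi_bour R n.+2 =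
    fun x : Cplx R => (n.+1%:R * n.+2%:R * n.+3%:R)^-1 * x ^+ n.+3.
  by apply/funext => x; rewrite /phi_bour subn1 addn1.
have n2E : n.+2%:R = n.+1%:R + 1 :> Cplx R by rewrite natr1.
have n3E : n.+3%:R = n.+1%:R + 1 + 1 :> Cplx R by rewrite !natr1.
have := nz n.+2; have := nz n.+1; have := nz n.
rewrite /weierstrass phiE derive1nS derive1n1 !derive1_monomial /= !exprS n2E n3E.
(* With $N = m-1$ and $W = w^{m-2}$ abstracted, each entry is a rational identity in $N$, $W$,
   $w$. *)
move: (n.+1%:R : Cplx R) (w ^+ n) => N W N1 N2 N3.
congr (map_mx _ (vec3 _ _ _)).
- by field; rewrite N1 N2 N3.
- by congr (_ * _); field; rewrite N1 N2 N3.
- by field; rewrite N1 N2 N3.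
Qed.

Theorem mainTheorem5 (R : realType) (m : nat) (hm : (2 <= m)%N)
    (r theta : R) :
  weierstrass (@phi_bour R m) (polar r theta) = bour m r theta.
Proof.
case: m hm => [|[|n]] // _; rewrite weierstrass_phi_bour !polarX.
rewrite /bour subn1 addn1 /=.
apply/matrixP => i j; rewrite !mxE.
case: i => [[|[|[|//]]] ?]; rewrite !(tnth_nth 0) /=.
- by rewrite raddfB /= !Re_divn /= !mulrA.
- rewrite Re_mulil raddfD /= !Im_divn /=; ring.
(* The factor 2 becomes [*+ 2], which the additive map [Re] respects. *)
- rewrite mulr_natl raddfMn /= Re_divn /= -mulr_natl; ring.
Qed.
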